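(* Consider $N$ agents $\dot x_i(t)=Ax_i(t)+B_iu_i(t)$ with the control law $u_i(t)=(K_i+\Delta_{K_i}(t))\hat{\mathbb{X}}_i(t)$, the event-triggering rule $$t_{k+1}^i=\inf\{t>t_k^i:\ \|e_i(t)\|-\phi\|\hat{\mathbb{X}}_i(t)\|\ge0\},$$ and design parameters $\phi=\sqrt{\tau_3\gamma^{-1}}$, $K_i=B_i^\dagger\mathscr{P}^{-1}\Theta_i$ obtained from a solution of the LMI optimization problem described in the context. Let $\delta_{c_i}>0$ be the given stopping threshold of agent $i$, and suppose the stopping criterion $\|\hat{\mathbb{X}}_i\|<\delta_{c_i}$ is not met at the triggering instant $t_k^i$, i.e. $\|\hat{\mathbb{X}}_i(t_k^i)\|\ge\delta_{c_i}$. Then the inter-event interval of agent $i$ is strictly positive and satisfies $$t_{k+1}^i-t_k^i\ \ge\ \frac{1}{\|A\|}\ln\left(\frac{\phi\,\|A\|\,\|\hat{\mathbb{X}}_i(t_k^i)\|}{\overline{F}_i^k}+1\right),\qquad \overline{F}_i^k=\max_{t\in[t_k^i,t_{k+1}^i)}\big\|A\hat x_i(t)+B_i(K_i+\Delta_{K_i}(t))\hat{\mathbb{X}}_i(t)\big\|.$$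
   Context: Notation: $\otimes$ is the Kronecker product, $\circ$ the Hadamard product, $X^\dagger$ the Moore–Penrose pseudo-inverse, $\mathbf{1}_k$ the all-ones column vector in $\mathbb{R}^k$; $\|\cdot\|$ is the Euclidean norm of a vector and the Frobenius norm of a matrix; $X>0$ ($X<0$) means symmetric positive (negative) definite. It is understood that $A\ne0$ and $\overline{F}_i^k>0$, so that the bound is meaningful. Network: $N$ agents communicate over a directed weighted graph with adjacency matrix $\{a_{ij}\}$, $a_{ii}=0$, $a_{ij}>0$ if agent $j$ transmits to agent $i$ and $a_{ij}=0$ otherwise, with Laplacian $L=\{l_{ij}\}=\mathrm{diag}(\sum_ja_{1j},\dots,\sum_ja_{Nj})-\{a_{ij}\}$. The graph contains a directed spanning tree. $\hat L\in\mathbb{R}^{(N-1)\times N}$ is $L$ with its $N$-th row removed, assumed of full row rank. Put $L_{\langle n\rangle}=L\otimes I_n$, $\hat L_{\langle n\rangle}=\hat L\otimes I_n$, $\mathbb{L}=L_{\langle n\rangle}\hat L_{\langle n\rangle}^\dagger$; $[\alpha_1,\dots,\alpha_{N-1}]=l_{(N,\bullet)}\hat L^\dagger$ with $l_{(N,\bullet)}$ the $N$-th row of $L$; $M=\{l_{ij}+\alpha_jl_{iN}\}_{1\le i,j\le N-1}$, $M_{\langle n\rangle}=M\otimes I_n$. Agents and protocol: $x_i(t)\in\mathbb{R}^n$, $u_i(t)\in\mathbb{R}^m$, each $(A,B_i)$ controllable, $B=\mathrm{diag}(B_1,\dots,B_N)$. Agent $i$ transmits its state at times $0=t_0^i<t_1^i<\cdots$;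 $\hat x_i(t)=x_i(t_k^i)$ for $t\in[t_k^i,t_{k+1}^i)$; $e_i(t)=\hat x_i(t)-x_i(t)$ (so $e_i(t_k^i)=0$); $\hat{\mathbb{X}}_i(t)=\sum_{j=1}^Nl_{ij}\hat x_j(t)$. The perturbation $\Delta_K(t)=\mathrm{diag}(\Delta_{K_1}(t),\dots,\Delta_{K_N}(t))$, $\Delta_{K_i}(t)\in\mathbb{R}^{m\times n}$, satisfies $\|\Delta_K(t)\|\le\delta$ for all $t$. Agent $i$ runs the protocol until $\|\hat{\mathbb{X}}_i(t)\|<\delta_{c_i}$. LMI optimization problem defining the design parameters: for given constants $\delta,\zeta>0$, minimize $\gamma+\mu+\sum_{i=1}^N\upsilon_i$ over $\Theta_i\in\mathbb{R}^{n\times n}$, $\mathscr{P}\in\mathbb{R}^{n\times n}$ symmetric positive definite, and positive scalars $\tau_1,\tau_2,\tau_3,\gamma,\mu,\upsilon_1,\dots,\upsilon_N$, subject to $$\begin{bmatrix}\Pi_1&\Pi_2\\ \Pi_2^T&\Pi_3\end{bmatrix}<0,\quad \begin{bmatrix}\mu I&I\\ I&\mathscr{P}\end{bmatrix}>0,\quad \begin{bmatrix}-\Upsilon&\Theta^T\\ \Theta&-I\end{bmatrix}<0,$$ where $\Theta=\mathrm{diag}(\Theta_1,\dots,\Theta_N)$, $\Upsilon=\mathrm{diag}(\upsilon_1I_n,\dots,\upsilon_NI_n)$, $P=I_{N-1}\otimes\mathscr{P}$, $\Gamma=\gamma I_{n(N-1)}$, $\Xi=(\hat L\otimes\mathbf{1}_n\mathbf{1}_n^T)\circ(\mathbf{1}_{N-1}\otimes[\Theta_1,\dots,\Theta_N])$,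 $$\Pi_1=\begin{bmatrix}\pi_{11}&\Xi\mathbb{L}\\ (\Xi\mathbb{L})^T&\tau_2\delta^2\mathbb{L}^T\mathbb{L}-\tau_3I\end{bmatrix},\ \Pi_2=\begin{bmatrix}P\hat L_{\langle n\rangle}B&P\hat L_{\langle n\rangle}B&\tau_3M_{\langle n\rangle}^T\\0&0&\tau_3M_{\langle n\rangle}^T\end{bmatrix},\ \Pi_3=\mathrm{diag}(-\tau_1I,-\tau_2I,-\Gamma),$$ $$\pi_{11}=(I_{N-1}\otimes A)^TP+P(I_{N-1}\otimes A)+2\zeta P+\tau_1\delta^2\mathbb{L}^T\mathbb{L}+\Xi\mathbb{L}+\mathbb{L}^T\Xi^T.$$
   Formalization: The displayed bound (not the strict positivity) is proved assuming the monitored norm of X̂_i when event k+1 fires is at least its norm at t_k^i, as it fails if neighbours' transmissions shrink X̂_i; ''solution'' means optimal up to any gap ε≥0, and the max is read as a supremum. *)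

(* Defs.v *)
(* MathComp-Analysis; the reals are an arbitrary [R : realType]. *)
From HB Require Import structures.
From mathcomp Require Import all_boot all_order all_algebra.
From mathcomp.real_closed Require Import mxtens.
From mathcomp Require Import all_classical all_reals all_analysis.

Set Implicit Arguments.
Unset Strict Implicit.
Unset Printing Implicit Defensive.

Import Order.TTheory GRing.Theory Num.Theory.
Local Open Scope classical_set_scope.
Local Open Scope ring_scope.

(* The library norm on ['M[R]_(m, n)] is the max norm.  [fnorm] is the Frobenius
   norm, hence the Euclidean norm on columns. *)
Definition fnorm (R : realType) (m n : nat) (X : 'M[R]_(m, n)) : R :=
  Num.sqrt (\sum_i \sum_j X i j ^+ 2).

Definition posdef (R : realType) (n : nat) (X : 'M[R]_n) : Prop :=
  X^T = X /\ forall v : 'cV[R]_n, v != 0 -> 0 < (v^T *m X *m v) 0 0.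

Definition negdef (R : realType) (n : nat) (X : 'M[R]_n) : Prop :=
  X^T = X /\ forall v : 'cV[R]_n, v != 0 -> (v^T *m X *m v) 0 0 < 0.

Definition penrose (R : realType) (m n : nat) (X : 'M[R]_(m, n))
    (Y : 'M[R]_(n, m)) : Prop :=
  [/\ X *m Y *m X = X, Y *m X *m Y = Y,
      (X *m Y)^T = X *m Y & (Y *m X)^T = Y *m X].

Definition mpinv (R : realType) (m n : nat) (X : 'M[R]_(m, n)) : 'M[R]_(n, m) :=
  xget 0 [set Y | penrose X Y].

Lemma row_mulmx_tr_eq0 (R : realType) (n : nat) (v : 'rV[R]_n) :
  v *m v^T = 0 -> v = 0.
Proof.
move=> /matrixP/(_ 0 0); rewrite !mxE => /eqP.
rewrite psumr_eq0; last by move=> j _; rewrite mxE -expr2 sqr_ge0.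
move=> /allP h; apply/rowP => j; rewrite mxE.
by have := h j; rewrite mem_index_enum mxE /= mulf_eq0 orbb => /(_ isT)/eqP.
Qed.

Lemma gram_unitmx (R : realType) (r n : nat) (X : 'M[R]_(r, n)) :
  row_free X -> X *m X^T \in unitmx.
Proof.
move=> Xfree; rewrite -row_free_unit; apply: inj_row_free => v v0.
have : (v *m X) *m (v *m X)^T = 0.
  by rewrite trmx_mul !mulmxA -(mulmxA v X) v0 mul0mx.
move/row_mulmx_tr_eq0 => vX0.
by apply: (row_free_inj Xfree); rewrite vX0 mul0mx.
Qed.

Lemma mpinvP (R : realType) (m n : nat) (X : 'M[R]_(m, n)) :
  penrose X (mpinv X).
Proof.
suff [Y XY] : exists Y, penrose X Y by apply: (@xgetPex _ 0 [set Z | penrose X Z]); exists Y.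
have [r [C [D [-> uC uD]]]] : exists r (C : 'M[R]_(m, r)) (D : 'M[R]_(r, n)),
    [/\ X = C *m D, C^T *m C \in unitmx & D *m D^T \in unitmx].
  exists (\rank X), (col_base X), (row_base X); split.
  - by rewrite mulmx_base.
  - rewrite -{2}[col_base X]trmxK; apply: gram_unitmx.
    by rewrite /row_free mxrank_tr; exact: col_base_full.
  - by apply: gram_unitmx; exact: row_base_free.
pose S := invmx (D *m D^T); pose T := invmx (C^T *m C).
have DS : D *m D^T *m S = 1%:M by rewrite mulmxV.
have TC : T *m (C^T *m C) = 1%:M by rewrite mulVmx.
have St : S^T = S by rewrite trmx_inv trmx_mul trmxK.
have Tt : T^T = T by rewrite trmx_inv trmx_mul trmxK.
pose Y := D^T *m S *m (T *m C^T).
have XY : C *m D *m Y = C *m T *m C^T.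
  by rewrite /Y -(mulmxA C D) (mulmxA D) (mulmxA D) DS mul1mx mulmxA.
have YX : Y *m (C *m D) = D^T *m S *m D.
  rewrite /Y -(mulmxA (D^T *m S)) (mulmxA (T *m C^T)) -(mulmxA T) TC.
  by rewrite mul1mx.
exists Y; split.
- by rewrite XY mulmxA -(mulmxA (C *m T)) -(mulmxA C) TC mulmx1.
- by rewrite YX /Y mulmxA -(mulmxA _ D) (mulmxA D) DS mulmx1.
- by rewrite XY !trmx_mul trmxK Tt mulmxA.
- by rewrite YX !trmx_mul trmxK St mulmxA.
Qed.

Lemma penrose_uniq (R : realType) (m n : nat) (X : 'M[R]_(m, n))
    (Y Z : 'M[R]_(n, m)) : penrose X Y -> penrose X Z -> Y = Z.
Proof.
move=> [Y1 Y2 Y3 Y4] [Z1 Z2 Z3 Z4].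
have E1 : X *m Y = X *m Z.
  by rewrite -Y3 -{1}Z1 -(mulmxA _ X) trmx_mul Y3 Z3 mulmxA Y1.
have E2 : Y *m X = Z *m X.
  by rewrite -Y4 -{1}Z1 -(mulmxA X) mulmxA trmx_mul Z4 Y4 -mulmxA (mulmxA X) Y1.
by rewrite -Y2 -mulmxA E1 mulmxA E2 Z2.
Qed.

Definition ones (R : realType) (k : nat) : 'cV[R]_k := const_mx 1.

(* Block matrices with N equal blocks use the index convention of [*t]:
   entry (i, a), (j, b) of the block (i, j) sits at [mxtens_index]. *)
Definition blockdiag (R : realType) (N m n : nat) (X : 'I_N -> 'M[R]_(m, n)) :
    'M[R]_(N * m, N * n) :=
  \matrix_(r, c)
    if (mxtens_unindex r).1 == (mxtens_unindex c).1
    then X (mxtens_unindex r).1 (mxtens_unindex r).2 (mxtens_unindex c).2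
    else 0.

Definition blockrow (R : realType) (N m n : nat) (X : 'I_N -> 'M[R]_(m, n)) :
    'M[R]_(m, N * n) :=
  \matrix_(a, c) X (mxtens_unindex c).1 a (mxtens_unindex c).2.

(* [a i j > 0] means that agent [j] transmits to agent [i]. *)
Definition adjacency (R : realType) (N : nat) (a : 'M[R]_N) : Prop :=
  (forall i, a i i = 0) /\ (forall i j, 0 <= a i j).

(* A directed spanning tree, given by its root and the parent of every node. *)
Definition has_spanning_tree (R : realType) (N : nat) (a : 'M[R]_N) : Prop :=
  exists (root : 'I_N) (parent : 'I_N -> 'I_N),
    (forall i, i != root -> 0 < a i (parent i)) /\
    (forall i, exists d : nat, iter d parent i = root).

Definition laplacian (R : realType) (N : nat) (a : 'M[R]_N) : 'M[R]_N :=
  diag_mx (\row_i \sum_j a i j) - a.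

Section Laplacian_blocks.

Context (R : realType) (p n : nat) (a : 'M[R]_p.+1).

Definition Lhat : 'M[R]_(p, p.+1) := row' ord_max (laplacian a).

Definition bigL : 'M[R]_(p.+1 * n, p.+1 * n) := laplacian a *t (1%:M : 'M[R]_n).

Definition bigLhat : 'M[R]_(p * n, p.+1 * n) := Lhat *t (1%:M : 'M[R]_n).

Definition LL : 'M[R]_(p.+1 * n, p * n) := bigL *m mpinv bigLhat.

Definition alpha : 'rV[R]_p := row ord_max (laplacian a) *m mpinv Lhat.

Definition Mmx : 'M[R]_p :=
  \matrix_(i, j) (laplacian a (lift ord_max i) (lift ord_max j)
                  + alpha 0 j * laplacian a (lift ord_max i) ord_max).

Definition bigM : 'M[R]_(p * n, p * n) := Mmx *t (1%:M : 'M[R]_n).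

End Laplacian_blocks.

Record lmi_vars (R : realType) (N n : nat) := LmiVars {
  Theta : 'I_N -> 'M[R]_n;
  calP : 'M[R]_n;
  tau1 : R;
  tau2 : R;
  tau3 : R;
  gam : R;
  mu_ : R;
  upsilon : 'I_N -> R
}.

Section LMI.

Context (R : realType) (p n m : nat).
Context (a : 'M[R]_p.+1) (A : 'M[R]_n) (B : 'I_p.+1 -> 'M[R]_(n, m)).
Context (delta zeta : R) (d : lmi_vars R p.+1 n).

Definition bigP : 'M[R]_(p * n, p * n) := (1%:M : 'M[R]_p) *t calP d.

Definition Xi : 'M[R]_(p * n, p.+1 * n) :=
  map2_mx *%R
    (Lhat a *t (ones R n *m (ones R n)^T))
    (castmx (erefl, mul1n _) (ones R p *t blockrow (Theta d))).

Definition pi11 : 'M[R]_(p * n) :=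
  ((1%:M : 'M[R]_p) *t A)^T *m bigP + bigP *m ((1%:M : 'M[R]_p) *t A)
  + (2 * zeta) *: bigP
  + (tau1 d * delta ^+ 2) *: ((LL n a)^T *m LL n a)
  + Xi *m LL n a + (LL n a)^T *m Xi^T.

Definition Pi1 : 'M[R]_(p * n + p * n) :=
  block_mx pi11               (Xi *m LL n a)
           (Xi *m LL n a)^T   ((tau2 d * delta ^+ 2) *: ((LL n a)^T *m LL n a)
                               - (tau3 d)%:M).

Definition Pi2 : 'M[R]_(p * n + p * n, (p.+1 * m + p.+1 * m) + p * n) :=
  let PLB := bigP *m bigLhat n a *m blockdiag B in
  block_mx (row_mx PLB PLB) (tau3 d *: (bigM n a)^T)
           0                (tau3 d *: (bigM n a)^T).

Definition Pi3 : 'M[R]_((p.+1 * m + p.+1 * m) + p * n) :=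
  block_mx (block_mx (- tau1 d)%:M 0 0 (- tau2 d)%:M) 0
           0                                          (- gam d)%:M.

Definition lmi_feasible : Prop :=
  [/\ posdef (calP d),
      [/\ 0 < tau1 d, 0 < tau2 d, 0 < tau3 d, 0 < gam d & 0 < mu_ d],
      (forall i, 0 < upsilon d i),
      negdef (block_mx Pi1 Pi2 Pi2^T Pi3)
    & posdef (block_mx (mu_ d)%:M 1%:M 1%:M (calP d) : 'M[R]_(n + n))
      /\ negdef (block_mx (- blockdiag (fun i => (upsilon d i)%:M : 'M[R]_n))
                          (blockdiag (Theta d))^T
                          (blockdiag (Theta d)) (- 1%:M)
                 : 'M[R]_(p.+1 * n + p.+1 * n))].

Definition lmi_cost : R := gam d + mu_ d + \sum_i upsilon d i.

(* Event-triggering coefficient and nominal gains. *)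
Definition phi : R := Num.sqrt (tau3 d * (gam d)^-1).

Definition gain (i : 'I_p.+1) : 'M[R]_(m, n) :=
  mpinv (B i) *m invmx (calP d) *m Theta d i.

End LMI.

(* A solution of the LMI optimization problem up to an optimality gap [eps].
   The feasible set is open (all constraints are strict) and the cost is a
   nonconstant linear function, so the infimum is never attained: requiring
   [eps = 0] alone would leave no solution at all. *)
Definition lmi_solution (R : realType) (p n m : nat)
    (a : 'M[R]_p.+1) (A : 'M[R]_n) (B : 'I_p.+1 -> 'M[R]_(n, m))
    (delta zeta eps : R) (d : lmi_vars R p.+1 n) : Prop :=
  lmi_feasible a A B delta zeta d /\
  forall d' : lmi_vars R p.+1 n,
    lmi_feasible a A B delta zeta d' -> lmi_cost d <= lmi_cost d' + eps.

(* [x' = A x + B u] on [[0, T[] in the sense of Caratheodory, so that inputs that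
   are piecewise constant or merely integrable are allowed. *)
Definition lti_solution (R : realType) (n m : nat) (A : 'M[R]_n)
    (B : 'M[R]_(n, m)) (T : \bar R) (u : R -> 'cV[R]_m) (x : R -> 'cV[R]_n) : Prop :=
  forall (t : R) (r : 'I_n), 0 <= t -> (t%:E < T)%E ->
    let f := fun s : R => (A *m x s + B *m u s) r 0 in
    (@lebesgue_measure R).-integrable `[0, t] (EFin \o f) /\
    x t r 0 = x 0 r 0 + \int[@lebesgue_measure R]_(s in `[0, t]) f s.

Definition controllable (R : realType) (n m : nat) (A : 'M[R]_n)
    (B : 'M[R]_(n, m)) : Prop :=
  forall x0 x1 : 'cV[R]_n, exists (T : R) (u : R -> 'cV[R]_m) (x : R -> 'cV[R]_n),
    [/\ 0 < T, lti_solution A B +oo u x, x 0 = x0 & x T = x1].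

(* [tk i k] is the k-th transmission time of agent [i]; it is [+oo] when there is
   no such transmission. *)
Record trajectory (R : realType) (N n m : nat) := Trajectory {
  tk : 'I_N -> nat -> \bar R;
  state : 'I_N -> R -> 'cV[R]_n;
  xhat : 'I_N -> R -> 'cV[R]_n;
  input : 'I_N -> R -> 'cV[R]_m;
  DeltaK : 'I_N -> R -> 'M[R]_(m, n)
}.

Section Protocol.

Context (R : realType) (p n m : nat).
Context (a : 'M[R]_p.+1) (A : 'M[R]_n) (B : 'I_p.+1 -> 'M[R]_(n, m)).
Context (K : 'I_p.+1 -> 'M[R]_(m, n)) (ph delta : R) (deltac : 'I_p.+1 -> R).
Context (T : \bar R) (w : trajectory R p.+1 n m).

Definition Xhat (i : 'I_p.+1) (t : R) : 'cV[R]_n :=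
  \sum_j laplacian a i j *: xhat w j t.

(* The sample [x_i(t_k^i)] (meaningful when [tk w i k] is finite). *)
Definition sample (i : 'I_p.+1) (k : nat) : 'cV[R]_n := state w i (fine (tk w i k)).

(* The signals that agent [i] monitors from its k-th transmission on: its own
   sample stays equal to [x_i(t_k^i)] until agent [i] transmits again, while
   the samples of the other agents are updated when they arrive.  On
   [[t_k^i, t_(k+1)^i[] these are [e_i] and [Xhat i]; at the time
   [t_(k+1)^i] they are the values that fire the event, before [e_i] is reset. *)
Definition held_error (i : 'I_p.+1) (k : nat) (t : R) : 'cV[R]_n :=
  sample i k - state w i t.

Definition held_Xhat (i : 'I_p.+1) (k : nat) (t : R) : 'cV[R]_n :=
  \sum_j laplacian a i j *: (if j == i then sample i k else xhat w j t).

(* Agent [i] has not met its stopping criterion up to time [t]. *)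
Definition running (i : 'I_p.+1) (t : R) : Prop :=
  forall s, 0 <= s <= t -> deltac i <= fnorm (Xhat i s).

Definition trigger_set (i : 'I_p.+1) (k : nat) : set R :=
  [set t | [/\ (tk w i k < t%:E)%E, (t%:E < T)%E,
               (forall s, 0 <= s < t -> running i s)
             & 0 <= fnorm (held_error i k t) - ph * fnorm (held_Xhat i k t)]].

(* The closed loop on a horizon [[0, T[], with [T] possibly [+oo], on which all
   sampled signals are defined.  Letting [T] be finite means that the absence of
   accumulation points of the transmission times is not assumed beforehand.
   Nothing is required of [u_i] once agent [i] has stopped. *)
Definition closed_loop : Prop :=
  (0 < T)%E /\
  (forall i, tk w i 0 = 0%E) /\
  (forall i k, tk w i k.+1 = ereal_inf [set t%:E | t in trigger_set i k]) /\
  (forall i (t : R), 0 <= t -> (t%:E < T)%E ->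
     exists k, (tk w i k <= t%:E < tk w i k.+1)%E) /\
  (forall i k (t : R), (t%:E < T)%E -> (tk w i k <= t%:E < tk w i k.+1)%E ->
     xhat w i t = sample i k) /\
  (forall i (t : R), 0 <= t -> (t%:E < T)%E -> running i t ->
     input w i t = (K i + DeltaK w i t) *m Xhat i t) /\
  (forall i, lti_solution A (B i) T (input w i) (state w i)) /\
  (forall t : R, 0 <= t -> fnorm (blockdiag (fun i => DeltaK w i t)) <= delta).

(* The supremum equals the maximum whenever the latter exists; a [DeltaK] that is
   only bounded need not attain it. *)
Definition Fbar (i : 'I_p.+1) (k : nat) : R :=
  sup [set fnorm (A *m xhat w i t + B i *m (K i + DeltaK w i t) *m Xhat i t)
      | t in [set t : R | (tk w i k <= t%:E < tk w i k.+1)%E /\ (t%:E < T)%E]].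

(* Transmissions of in-neighbours may change [Xhat i] between two events of agent
   [i], and a drop of its norm fires the next event earlier than the threshold
   [ph * fnorm (Xhat i t_k^i)] would.  This predicate says that the norm that
   enters the threshold when the event of index [k.+1] fires is at least the one at
   [t_k^i]; it holds in particular if no in-neighbour transmits on
   []t_k^i, t_(k+1)^i]]. *)
Definition threshold_kept (i : 'I_p.+1) (k : nat) : Prop :=
  forall t : R, tk w i k.+1 = t%:E ->
    fnorm (Xhat i (fine (tk w i k))) <= fnorm (held_Xhat i k t).

End Protocol.

(* Main.v *)
Require Import Defs.
From HB Require Import structures.
From mathcomp Require Import all_boot all_order all_algebra.
From mathcomp.real_closed Require Import mxtens.
From mathcomp Require Import all_classical all_reals all_analysis.
From mathcomp Require Import ring lra.

Set Implicit Arguments.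
Unset Strict Implicit.
Unset Printing Implicit Defensive.

Import Order.TTheory GRing.Theory Num.Theory.
Import numFieldNormedType.Exports.
Local Open Scope classical_set_scope.
Local Open Scope ring_scope.

(* Let [e(t) = x_i(t_k) - x_i(t)].  From one transmission to the next,
   [e' = A e - (A xhat_i + B_i u_i)], so [|e(t)|] is at most the integral of
   [|A| |e| + F] and Gronwall's inequality gives
   [|e(t)| <= F / |A| (exp (|A| (t - t_k)) - 1)].  The samples are constant to
   the right of every instant and [e] is continuous, so the triggering condition
   is stable under limits from the right and holds at [t_(k+1)] itself; it fails
   at [t_k], where [e = 0] and the threshold is positive, hence
   [t_k < t_(k+1)].  At [t_(k+1)] it reads [phi |Xhat_i| <= |e|]; combined with
   Gronwall's bound, it is solved for [t_(k+1) - t_k]. *)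

(** * Cauchy-Schwarz inequality and the Frobenius norm *)

Lemma CauchySchwarz_sum (R : realFieldType) (I : finType) (x y : I -> R) :
  (\sum_i x i * y i) ^+ 2 <= (\sum_i x i ^+ 2) * (\sum_i y i ^+ 2).
Proof.
set a := \sum_i x i ^+ 2; set b := \sum_i x i * y i; set c := \sum_i y i ^+ 2.
have a0 : 0 <= a by apply: sumr_ge0 => i _; exact: sqr_ge0.
have : 0 <= \sum_i (a * y i - b * x i) ^+ 2.
  by apply: sumr_ge0 => i _; exact: sqr_ge0.
(* For [a > 0] the factor [a] can be cancelled. The case [a = 0], where every [x i] vanishes, is
   treated apart. *)
have -> : \sum_i (a * y i - b * x i) ^+ 2 = a * (a * c - b ^+ 2).
  transitivity (\sum_i (a ^+ 2 * y i ^+ 2 +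
      (- 2 * a * b * (x i * y i) + b ^+ 2 * x i ^+ 2))).
    by apply: eq_bigr => i _; ring.
  by rewrite !big_split /= -!mulr_sumr -/a -/b -/c; ring.
move: a0; rewrite le_eqVlt => /predU1P[a0 _|a0].
  suff -> : b = 0 by rewrite expr0n -a0 mul0r.
  apply: big1 => i _; have /eqP := esym a0; rewrite psumr_eq0; last first.
    by move=> j _; exact: sqr_ge0.
  move=> /allP/(_ i); rewrite mem_index_enum sqrf_eq0 => /(_ isT)/eqP ->.
  by rewrite mul0r.
by rewrite pmulr_rge0// subr_ge0.
Qed.

Section frobenius_norm.
Variable R : realType.

Lemma fnorm_ge0 (m n : nat) (X : 'M[R]_(m, n)) : 0 <= fnorm X.
Proof. exact: sqrtr_ge0. Qed.

Lemma sqr_fnorm (m n : nat) (X : 'M[R]_(m, n)) :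
  fnorm X ^+ 2 = \sum_i \sum_j X i j ^+ 2.
Proof.
by rewrite sqr_sqrtr//; do 2 (apply: sumr_ge0 => ? _); exact: sqr_ge0.
Qed.

Lemma sqr_fnorm_col (n : nat) (v : 'cV[R]_n) :
  fnorm v ^+ 2 = \sum_r v r 0 ^+ 2.
Proof. by rewrite sqr_fnorm; apply: eq_bigr => r _; rewrite big_ord1. Qed.

Lemma fnorm0 (m n : nat) : fnorm (0 : 'M[R]_(m, n)) = 0.
Proof.
by rewrite /fnorm big1 ?sqrtr0// => i _; rewrite big1// => j _; rewrite mxE expr0n.
Qed.

Lemma fnorm_gt0 (m n : nat) (X : 'M[R]_(m, n)) : X != 0 -> 0 < fnorm X.
Proof.
move=> X0; rewrite lt_neqAle fnorm_ge0 andbT eq_sym; apply: contra X0 => /eqP N0.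
have /eqP := sqr_fnorm X; rewrite N0 expr0n eq_sym psumr_eq0; last first.
  by move=> i _; apply: sumr_ge0 => j _; exact: sqr_ge0.
move=> /allP S0; apply/eqP/matrixP => i j; rewrite mxE.
have := S0 i; rewrite mem_index_enum psumr_eq0 => [/(_ isT)/allP/(_ j)|k _].
  by rewrite mem_index_enum sqrf_eq0 => /(_ isT)/eqP.
exact: sqr_ge0.
Qed.

Lemma ler_sum_fnorm (n : nat) (u v : 'cV[R]_n) :
  \sum_r u r 0 * v r 0 <= fnorm u * fnorm v.
Proof.
apply: le_trans (ler_norm _) _.
rewrite -(ler_pXn2r (_ : 0 < 2)%N) ?nnegrE ?mulr_ge0 ?fnorm_ge0//.
by rewrite real_normK ?num_real// exprMn !sqr_fnorm_col; exact: CauchySchwarz_sum.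
Qed.

(** Cauchy-Schwarz is applied to each row of [X], and the squares are summed. *)
Lemma fnorm_mulmx (m n : nat) (X : 'M[R]_(m, n)) (v : 'cV[R]_n) :
  fnorm (X *m v) <= fnorm X * fnorm v.
Proof.
rewrite -(ler_pXn2r (_ : 0 < 2)%N) ?nnegrE ?mulr_ge0 ?fnorm_ge0//.
rewrite exprMn !sqr_fnorm_col sqr_fnorm mulr_suml.
by apply: ler_sum => i _; rewrite mxE; exact: CauchySchwarz_sum.
Qed.

Lemma fnormN (m n : nat) (X : 'M[R]_(m, n)) : fnorm (- X) = fnorm X.
Proof.
congr Num.sqrt; apply: eq_bigr => i _; apply: eq_bigr => j _.
by rewrite mxE sqrrN.
Qed.

Lemma fnormD_col (n : nat) (u v : 'cV[R]_n) : fnorm (u + v) <= fnorm u + fnorm v.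
Proof.
rewrite -(ler_pXn2r (_ : 0 < 2)%N) ?nnegrE ?addr_ge0 ?fnorm_ge0//.
have -> : fnorm (u + v) ^+ 2 =
    fnorm u ^+ 2 + fnorm v ^+ 2 + 2 * \sum_r u r 0 * v r 0.
  rewrite !sqr_fnorm_col mulr_sumr -!big_split /=.
  by apply: eq_bigr => r _; rewrite mxE; ring.
have := ler_sum_fnorm u v; nra.
Qed.

End frobenius_norm.

(** * Integrals of vector-valued functions *)

Section vector_integral.
Context d (T : measurableType d) (R : realType) (mu : {measure set T -> \bar R}).

Lemma integrable_sum_scale (n : nat) (D : set T) (c : 'I_n -> R)
    (f : 'I_n -> T -> R) : measurable D ->
    (forall r, mu.-integrable D (EFin \o f r)) ->
  mu.-integrable D (EFin \o (fun s => \sum_r c r * f r s)) /\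
  \int[mu]_(s in D) (\sum_r c r * f r s) = \sum_r c r * \int[mu]_(s in D) f r s.
Proof.
move=> mD; elim: n c f => [|n IH] c f fi.
  split; last first.
    under eq_Rintegral do rewrite big_ord0.
    by rewrite big_ord0 (Rintegral_cst _ mD) mul0r.
  by apply: (eq_integrable mD _ _ _ (integrable0 mu D)) => s _ /=; rewrite big_ord0.
have [IHi IHe] := IH (fun r => c (lift ord0 r)) (fun r => f (lift ord0 r))
  (fun r => fi _).
have f0i : mu.-integrable D (EFin \o (fun s => c ord0 * f ord0 s)).
  exact: (integrableZl mD (c ord0) (fi ord0)).
have E s : \sum_r c r * f r s =
    c ord0 * f ord0 s + \sum_(r < n) c (lift ord0 r) * f (lift ord0 r) s.
  by rewrite big_ord_recl.
split.
  by apply: (eq_integrable mD _ _ _ (integrableD mD f0i IHi)) => s _ /=; rewrite E EFinD.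
under eq_Rintegral do rewrite E.
by rewrite RintegralD// RintegralZl// IHe big_ord_recl.
Qed.

(* Testing the vector integral against itself reduces the bound to the scalar
   one by Cauchy-Schwarz. *)
Lemma fnorm_le_Rintegral (n : nat) (D : set T) (v : 'cV[R]_n) (f : T -> 'cV[R]_n)
    (h : T -> R) : measurable D ->
    (forall r, mu.-integrable D (EFin \o (fun s => f s r 0))) ->
    mu.-integrable D (EFin \o h) ->
    (forall r, v r 0 = \int[mu]_(s in D) f s r 0) ->
    (forall s, D s -> fnorm (f s) <= h s) ->
  fnorm v <= \int[mu]_(s in D) h s.
Proof.
move=> mD fi hi vE fh.
have h0 : 0 <= \int[mu]_(s in D) h s.
  by apply: Rintegral_ge0 => s /fh; exact/le_trans/fnorm_ge0.
have := fnorm_ge0 v; rewrite le_eqVlt => /predU1P[<-//|v0].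
rewrite -(ler_pM2l v0) -expr2 sqr_fnorm_col.
under eq_bigr do rewrite expr2 {2}vE.
have [vi <-] := integrable_sum_scale (fun r => v r 0) mD fi.
rewrite -RintegralZl//; apply: le_Rintegral => //.
  exact: (integrableZl mD (fnorm v) hi).
move=> s /fh fs; apply: le_trans (ler_sum_fnorm _ _) _.
by rewrite ler_pM2l.
Qed.

End vector_integral.

(** * One-sided neighbourhoods and Gronwall's inequality *)

Lemma within_continuous_lt_right (R : realType) (y : R -> R) (a b s c : R) :
    {within `[a, b], continuous y} -> a <= s < b -> y s < c ->
  \forall t \near s^'+, y t < c.
Proof.
move=> /(@subspace_continuousP R _ R y) yc /andP[as_ sb] ysc.
have sab : `[a, b]%classic s by rewrite /= in_itv /= as_ ltW.
have [e /= e0 eP] := yc _ sab _ (lt_nbhsl ysc).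
(* The radius [b - s] keeps the points to the right of [s] inside [[a, b]], where relative
   continuity gives information. *)
exists (Num.min e (b - s)); first by rewrite /= lt_min e0 subr_gt0.
move=> t /=; rewrite distrC lt_min => /andP[te tb] st.
apply: (eP t) => /=; first by rewrite distrC.
rewrite in_itv /= (le_trans as_ (ltW st)) /= ltW//.
by move: tb; rewrite gtr0_norm ?subr_gt0// ltrD2r.
Qed.

(** Let [G] be the integral of [al * y + F] from [t0]. The function [H t = (G t + F / al) * expR (-
    al * (t - t0))] has derivative [expR (- al * (t - t0)) * (al * (y t - G t))], which is
    nonpositive because [y <= G]. Comparing [H b] with [H t0 = F / al] bounds [G b], hence [y b]. *)
Lemma gronwall_integral (R : realType) (t0 b al F : R) (y : R -> R) :
    t0 <= b -> 0 < al -> {within `[t0, b], continuous y} ->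
    (forall t, t0 <= t <= b ->
      y t <= \int[@lebesgue_measure R]_(s in `[t0, t]) (al * y s + F)) ->
  y b <= F / al * (expR (al * (b - t0)) - 1).
Proof.
(* If [t0 = b], the integral over one point is zero, and so is the claimed bound. *)
move=> + al0 yc yG; rewrite le_eqVlt => /predU1P[t0b|t0b].
  have := yG b; rewrite t0b lexx set_itv1 Rintegral_set1 => /(_ isT).
  by rewrite subrr mulr0 expR0 subrr mulr0.
pose g s := al * y s + F.
have gc : {within `[t0, b], continuous g}.
  by move=> s; apply: cvgD; [apply: cvgMr; exact: yc|exact: cvg_cst].
have gi : (@lebesgue_measure R).-integrable `[t0, b] (EFin \o g).
  by apply: continuous_compact_integrable gc; exact: segment_compact.
pose G t := \int[@lebesgue_measure R]_(s in `[t0, t]) g s.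
pose H t := (G t + F / al) * expR (- al * (t - t0)).
have Gd t : t \in `]t0, b[ -> is_derive t 1 G (g t).
  move=> tI; have := tI; rewrite in_itv /= => /andP[tt0 tb].
  have gct : {for t, continuous g}.
    exact: (within_continuous_continuous t0b gc tI).
  have [Gdt Gt] := @continuous_FTC1 _ _ (BLeft t0) _ _ tb gi tt0 gct.
  by apply: DeriveDef => //; rewrite -derive1E.
have Hd t : t \in `]t0, b[ ->
    is_derive t 1 H (expR (- al * (t - t0)) * (al * (y t - G t))).
  move=> tI; have ? := Gd _ tI.
  rewrite /H; apply: is_derive_eq.
  rewrite /GRing.scale /= /g; field.
  exact: lt0r_neq0.
have Hc : {within `[t0, b], continuous H}.
  move=> t; apply: cvgM.
    apply: cvgD; last exact: cvg_cst.
    exact: (parameterized_integral_continuous (ltW t0b) gi).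
  apply: (@continuous_subspaceT _ _ _ (fun t => expR (- al * (t - t0)))) => s.
  apply: continuous_comp; last exact: continuous_expR.
  by apply: cvgMr; apply: cvgB; [exact: cvg_id|exact: cvg_cst].
have : H b <= H t0.
  apply: (ler0_derive1_le_cc _ _ Hc); rewrite ?in_itv /= ?lexx ?ltW//.
    by move=> t /Hd[].
  move=> t tI; rewrite derive1E; have [_ ->] := Hd _ tI.
  rewrite pmulr_rle0 ?expR_gt0// pmulr_rle0// subr_le0 yG//.
  by move: tI; rewrite in_itv /= => /andP[/ltW-> /ltW->].
have G0 : G t0 = 0 by rewrite /G set_itv1 Rintegral_set1.
rewrite /H G0 (subrr t0) mulr0 expR0 mulr1 add0r.
rewrite mulNr expRN ler_pdivrMr ?expR_gt0// => Hb; rewrite (mulrBr (F / al)) mulr1.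
by rewrite lerBrDr; apply: le_trans Hb; rewrite lerD2r yG// lexx ltW.
Qed.

(** * Increments and continuity of Caratheodory solutions *)

Section lti_solution.
Variables (R : realType) (n m : nat) (A : 'M[R]_n) (B : 'M[R]_(n, m)).
Variables (T : \bar R) (u : R -> 'cV[R]_m) (x : R -> 'cV[R]_n).
Hypothesis xsol : lti_solution A B T u x.

Lemma lti_solution_increment (s t : R) (r : 'I_n) :
    0 <= s <= t -> (t%:E < T)%E ->
  let f := fun s : R => (A *m x s + B *m u s) r 0 in
  (@lebesgue_measure R).-integrable `[s, t] (EFin \o f) /\
  x t r 0 - x s r 0 = \int[@lebesgue_measure R]_(z in `[s, t]) f z.
Proof.
move=> /andP[s0 st] tT f.
have sT : (s%:E < T)%E by apply: le_lt_trans tT; rewrite lee_fin.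
have [fi xt] := xsol r (le_trans s0 st) tT; have [_ xs] := xsol r s0 sT.
have fis : (@lebesgue_measure R).-integrable `[s, t] (EFin \o f).
  by apply: (integrableS _ _ _ fi) => //; apply: subset_itvr; rewrite bnd_simp.
split=> //; rewrite xt xs opprD addrACA subrr add0r.
(* The integrals over [[0, t]] and [[0, s]] differ by the one over []s, t]]; adding the null set of
   the point [s] closes the interval. *)
rewrite -(Rintegral_itv_obnd_cbnd (integrableS _ _ _ fis))//; last first.
  by apply: subset_itvr; rewrite bnd_simp.
by rewrite Rintegral_itvB// bnd_simp.
Qed.

(** Continuity is not part of [lti_solution]. It comes from the indefinite integral of an integrable
    function, with which each coordinate agrees on [[0, b]] up to a constant. *)
Lemma lti_solution_within_continuous (b : R) (r : 'I_n) :
    0 <= b -> (b%:E < T)%E ->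
  {within `[0, b], continuous (fun t => x t r 0)}.
Proof.
move=> b0 bT; have [fi _] := xsol r b0 bT.
apply: (@subspace_eq_continuous _ _ _ (fun t => x 0 r 0 +
    parameterized_integral (@lebesgue_measure R) 0 t
      (fun s => (A *m x s + B *m u s) r 0))).
  move=> t; rewrite inE /= in_itv /= => /andP[t0 tb].
  have tT : (t%:E < T)%E by apply: le_lt_trans bT; rewrite lee_fin.
  by have [_ xt] := xsol r t0 tT; rewrite /from_subspace xt.
move=> t; apply: cvgD; first exact: cvg_cst.
exact: (parameterized_integral_continuous b0 fi).
Qed.

Lemma fnormB_within_continuous (v : 'cV[R]_n) (b : R) :
    0 <= b -> (b%:E < T)%E ->
  {within `[0, b], continuous (fun t => fnorm (v - x t))}.
Proof.
move=> b0 bT.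
have vxc r : {within `[0, b], continuous (fun t => (v - x t) r 0)}.
  have -> : (fun t => (v - x t) r 0) = (fun t => v r 0 - x t r 0).
    by apply/funext => t; rewrite !mxE.
  move=> t; apply: cvgB; first exact: cvg_cst.
  exact: lti_solution_within_continuous.
move=> t; apply: (@continuous_comp _ _ _
  (fun t : subspace `[0, b] => \sum_i \sum_j (v - x t) i j ^+ 2)
  (@Num.sqrt R)); last exact: sqrt_continuous.
apply: cvg_big => [|r _]; first exact: add_continuous.
apply: cvg_big => [|j _]; first exact: add_continuous.
by rewrite ord1; exact: (cvgM (vxc r t) (vxc r t)).
Qed.

End lti_solution.

(** * Transmission times and the triggering condition *)

Section closed_loop.
Variables (R : realType) (p n m : nat).
Variables (a : 'M[R]_p.+1) (A : 'M[R]_n) (B : 'I_p.+1 -> 'M[R]_(n, m)).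
Variables (K : 'I_p.+1 -> 'M[R]_(m, n)) (ph delta : R) (deltac : 'I_p.+1 -> R).
Variables (T : \bar R) (w : trajectory R p.+1 n m).
Hypothesis cl : closed_loop a A B K ph delta deltac T w.

Local Notation trigger_set := (trigger_set a ph deltac T w).

Lemma tk0 i : tk w i 0 = 0%E.
Proof. by case: cl => _ [->]. Qed.

Lemma tkS i k : tk w i k.+1 = ereal_inf [set t%:E | t in trigger_set i k].
Proof. by case: cl => _ [_ [->]]. Qed.

Lemma tk_cover i t : 0 <= t -> (t%:E < T)%E ->
  exists k, (tk w i k <= t%:E < tk w i k.+1)%E.
Proof. by case: cl => _ [_ [_ [h _]]]; exact: h. Qed.

Lemma xhatE i k t : (t%:E < T)%E -> (tk w i k <= t%:E < tk w i k.+1)%E ->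
  xhat w i t = sample w i k.
Proof. by case: cl => _ [_ [_ [_ [h _]]]]; exact: h. Qed.

Lemma inputE i t : 0 <= t -> (t%:E < T)%E -> running a deltac w i t ->
  input w i t = (K i + DeltaK w i t) *m Xhat a w i t.
Proof. by case: cl => _ [_ [_ [_ [_ [h _]]]]]; exact: h. Qed.

Lemma state_lti i : lti_solution A (B i) T (input w i) (state w i).
Proof. by case: cl => _ [_ [_ [_ [_ [_ [h _]]]]]]; exact: h. Qed.

(** Only weak monotonicity is available here: the infimum of a set of times later than [t_k] may be
    [t_k] itself. *)
Lemma tk_homo i : {homo tk w i : k l / (k <= l)%N >-> (k <= l)%E}.
Proof.
apply: homo_leq => [x|x y z|k]; [exact: lexx|exact: le_trans|].
rewrite tkS; apply/ereal_infP => _ [t [kt _ _ _] <-]; exact: ltW.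
Qed.

Lemma tk_ge0 i k : (0 <= tk w i k)%E.
Proof. by rewrite -(tk0 i); exact: tk_homo. Qed.

(** A finite infimum comes from a nonempty trigger set, whose elements all lie before [T]. *)
Lemma tk_ltT i k : (tk w i k < +oo)%E -> (tk w i k < T)%E.
Proof.
case: k => [_|k]; first by rewrite tk0; case: cl.
rewrite {1}tkS => /ereal_inf_lt[_ [t kt <-] _].
have [_ tT _ _] := kt; apply: le_lt_trans tT.
by rewrite tkS; apply: ereal_inf_lbound; exists t.
Qed.

(* Coverage by the half-open intervals yields an index [q] with [t_q = t_k],
   even if several transmissions were to share the time [t_k]. *)
Lemma xhat_tk i k (s : R) : tk w i k = s%:E -> xhat w i s = sample w i k.
Proof.
move=> ks; have sT : (s%:E < T)%E by rewrite -ks tk_ltT// ks ltry.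
have s0 : 0 <= s by rewrite -lee_fin -ks tk_ge0.
have [q /andP[qs sq]] := tk_cover i s0 sT.
have kq : (k <= q)%N.
  rewrite leqNgt; apply/negP => /(tk_homo i); rewrite ks.
  by move=> /(lt_le_trans sq); rewrite ltxx.
have qE : tk w i q = s%:E.
  by apply/eqP; rewrite eq_le qs -ks tk_homo.
by rewrite (@xhatE i q) ?qs// /sample qE ks.
Qed.

(** The half-open interval between transmissions that contains [s] also contains a right
    neighbourhood of [s]. The guard on [t] is there because [closed_loop] prescribes [xhat] only
    before the horizon. *)
Lemma xhat_near_right j s : 0 <= s -> (s%:E < T)%E ->
  \forall t \near s^'+, (t%:E < T)%E -> xhat w j t = xhat w j s.
Proof.
move=> s0 sT; have [q /andP[qs sq]] := tk_cover j s0 sT.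
have near_tk : \forall t \near s^'+, (t%:E < tk w j q.+1)%E.
  case: (tk w j q.+1) sq => [r| |]//.
    by rewrite lte_fin; under eq_near do rewrite lte_fin; exact: nbhs_right_lt.
  by move=> _; apply: nearW => t; exact: ltry.
apply: filterS2 (nbhs_right_gt s) near_tk => t st tq tT.
rewrite (@xhatE j q t) ?tq ?andbT ?(le_trans qs) ?lee_fin ?ltW//.
by rewrite (@xhatE j q s) ?qs.
Qed.

Lemma held_Xhat_tk i k s : tk w i k = s%:E -> held_Xhat a w i k s = Xhat a w i s.
Proof.
move=> ks; apply: eq_bigr => j _.
by case: eqP => // ->; rewrite (xhat_tk ks).
Qed.

Lemma held_Xhat_near_right i k s : 0 <= s -> (s%:E < T)%E ->
  \forall t \near s^'+, (t%:E < T)%E -> held_Xhat a w i k t = held_Xhat a w i k s.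
Proof.
move=> s0 sT.
have : \forall t \near s^'+, forall j, (t%:E < T)%E -> xhat w j t = xhat w j s.
  by apply: filter_forall => j; exact: xhat_near_right.
apply: filterS => t xts tT; apply: eq_bigr => j _.
by case: eqP => // _; rewrite xts.
Qed.

Lemma not_trigger_near_right i k s : 0 <= s -> (s%:E < T)%E ->
    fnorm (held_error w i k s) < ph * fnorm (held_Xhat a w i k s) ->
  \forall t \near s^'+, ~ trigger_set i k t.
Proof.
move=> s0 sT es.
(* Any [b] strictly between [s] and [T] will do; it provides a compact interval on which the error
   is continuous. *)
have [b sb bT] : exists2 b : R, s < b & (b%:E < T)%E.
  case: T sT => [r| |]//; last by exists (s + 1); rewrite ?ltrDl ?ltry.
  rewrite lte_fin => sr; exists ((s + r) / 2); rewrite ?midf_lt//.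
  by rewrite lte_fin midf_lt.
have s0b : 0 <= s < b by rewrite s0.
have ec := fnormB_within_continuous (state_lti i) (v := sample w i k)
  (le_trans s0 (ltW sb)) bT.
have := within_continuous_lt_right ec s0b es.
apply: filterS2 (held_Xhat_near_right i k s0 sT) => t Xt et [_ tT _].
by rewrite Xt// subr_ge0 leNgt et.
Qed.

(** Trigger times come arbitrarily close to [s] from the right, so a strict failure at [s] would
    contradict [not_trigger_near_right]. The inequality thus holds even if [s] equals [t_k] and lies
    outside the trigger set, which is what later excludes [t_k = t_(k+1)]. *)
Lemma tkS_fin i k s : tk w i k.+1 = s%:E ->
  [/\ (s%:E < T)%E, forall z, 0 <= z < s -> running a deltac w i z
    & ph * fnorm (held_Xhat a w i k s) <= fnorm (held_error w i k s)].
Proof.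
move=> ks; have sT : (s%:E < T)%E by rewrite -ks tk_ltT// ks ltry.
have s0 : 0 <= s by rewrite -lee_fin -ks tk_ge0.
have st t : trigger_set i k t -> s <= t.
  by move=> kt; rewrite -lee_fin -ks tkS; apply: ereal_inf_lbound; exists t.
have trigger_before r : s < r -> exists2 t, trigger_set i k t & t < r.
  move=> sr; have : (ereal_inf [set t%:E | t in trigger_set i k] < r%:E)%E.
    by rewrite -tkS ks lte_fin.
  by move=> /ereal_inf_lt[_ [t kt <-]]; rewrite lte_fin => tr; exists t.
split=> //.
  have [t kt _] := trigger_before (s + 1) (ltr_pwDr ltr01 (lexx _)).
  have [_ _ run _] := kt => z /andP[z0 zs]; apply: run.
  by rewrite z0 (lt_le_trans zs (st _ kt)).
rewrite leNgt; apply/negP => es.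
have [e /= e0 eP] := not_trigger_near_right s0 sT es.
have [t kt tse] : exists2 t, trigger_set i k t & t < s + e.
  by apply: trigger_before; rewrite ltrDl.
have := st _ kt; rewrite le_eqVlt => /predU1P[ts|st'].
  by have [_ _ _] := kt; rewrite -ts subr_ge0 leNgt es.
apply: (eP t) => //=; rewrite distrC gtr0_norm ?subr_gt0//.
by rewrite ltrBlDl.
Qed.

Lemma tk_lt_tkS i k : 0 < ph -> (tk w i k < +oo)%E ->
    0 < fnorm (Xhat a w i (fine (tk w i k))) ->
  (tk w i k < tk w i k.+1)%E.
Proof.
move=> ph0 koo X0; rewrite lt_neqAle tk_homo// andbT; apply/eqP => kk.
have ks : tk w i k = (fine (tk w i k))%:E by rewrite fineK// ge0_fin_numE// tk_ge0.
move: X0; set s := fine _ in ks * => X0.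
have [_ _] := tkS_fin (etrans (esym kk) ks).
rewrite held_Xhat_tk// /held_error /sample -/s subrr fnorm0.
by rewrite leNgt mulr_gt0.
Qed.

(** * Growth of the error between two transmissions *)

Lemma Fbar_ge i k t : 0 < Fbar a A B K T w i k -> (t%:E < T)%E ->
    (tk w i k <= t%:E < tk w i k.+1)%E ->
  fnorm (A *m sample w i k + B i *m (K i + DeltaK w i t) *m Xhat a w i t)
    <= Fbar a A B K T w i k.
Proof.
rewrite /Fbar; set S := [set _ | _ in _] => F0 tT kt.
(* By convention [sup] is 0 on a set that is empty or unbounded above, so [0 < Fbar] yields
   boundedness. *)
have [_ Sub] : has_sup S.
  by apply: contrapT => /sup_out S0; move: F0; rewrite S0 ltxx.
by apply: (ub_le_sup Sub); exists t => //; rewrite (xhatE tT kt).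
Qed.

Lemma fnorm_held_error_le i k s t : A != 0 -> 0 < Fbar a A B K T w i k ->
    tk w i k = s%:E -> tk w i k.+1 = t%:E ->
  fnorm (held_error w i k t) <=
    Fbar a A B K T w i k / fnorm A * (expR (fnorm A * (t - s)) - 1).
Proof.
set F := Fbar _ _ _ _ _ _ _ _ => A0 F0 ks kt.
have [tT run _] := tkS_fin kt.
have s0 : 0 <= s by rewrite -lee_fin -ks tk_ge0.
have st : s <= t by rewrite -lee_fin -ks -kt tk_homo.
have ec : {within `[s, t], continuous (fun z => fnorm (held_error w i k z))}.
  apply: continuous_subspaceW (fnormB_within_continuous (state_lti i)
    (v := sample w i k) (le_trans s0 st) tT).
  by apply: subset_itvr; rewrite bnd_simp.
apply: (gronwall_integral st (fnorm_gt0 A0) ec) => z /andP[sz zt].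
have zT : (z%:E < T)%E by apply: le_lt_trans tT; rewrite lee_fin.
have hi : (@lebesgue_measure R).-integrable `[s, z]
    (EFin \o (fun y => fnorm A * fnorm (held_error w i k y) + F)).
  apply: continuous_compact_integrable; first exact: segment_compact.
  apply: (@continuous_subspaceW _ _ _ `[s, t]).
    by apply: subset_itvl; rewrite bnd_simp.
  by move=> y; apply: cvgD; [apply: cvgMr; exact: ec|exact: cvg_cst].
have inc r := lti_solution_increment (state_lti i) r
  (introT andP (conj s0 sz)) zT.
have ico f : (@lebesgue_measure R).-integrable `[s, z] (EFin \o f) ->
    (@lebesgue_measure R).-integrable `[s, z[ (EFin \o f).
  by apply: integrableS => //; apply: subset_itvl; rewrite bnd_simp.
(* The right end point, a null set, is dropped: [z] may be [t_(k+1)], whereas the control law and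
   the bound by [Fbar] are available only strictly before that time. *)
rewrite -Rintegral_itv_bndo_bndc; last exact: ico hi.
rewrite -fnormN opprB.
apply: (@fnorm_le_Rintegral _ _ _ (@lebesgue_measure R) _ _ _
  (fun y => A *m state w i y + B i *m input w i y)) => //.
- by move=> r; have [fi _] := inc r; exact: ico fi.
- exact: ico hi.
- move=> r; have [fi xr] := inc r; rewrite /sample ks !mxE /= xr.
  by rewrite Rintegral_itv_bndo_bndc//; exact: ico fi.
- move=> y; rewrite /= in_itv /= => /andP[sy yz].
  have yt := lt_le_trans yz zt.
  have y0 := le_trans s0 sy.
  have yT : (y%:E < T)%E by apply: lt_trans tT; rewrite lte_fin.
  have yk : (tk w i k <= y%:E < tk w i k.+1)%E by rewrite ks kt lee_fin lte_fin sy.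
  (* The state is the sample minus the error. The term in the error gives
     [fnorm A * fnorm (held_error w i k y)], and the rest is the vector whose norm [Fbar] bounds. *)
  have -> : A *m state w i y + B i *m input w i y =
      - (A *m held_error w i k y) +
      (A *m sample w i k + B i *m (K i + DeltaK w i y) *m Xhat a w i y).
    rewrite inputE//; last by apply: run; rewrite y0.
    by rewrite mulmxBr opprB addrA subrK mulmxA.
  apply: le_trans (fnormD_col _ _) _; rewrite fnormN lerD ?fnorm_mulmx//.
  exact: Fbar_ge.
Qed.

End closed_loop.

(** * Lower bound on the inter-event interval *)

Lemma phi_gt0 (R : realType) (p n m : nat) (a : 'M[R]_p.+1) (A : 'M[R]_n)
    (B : 'I_p.+1 -> 'M[R]_(n, m)) (delta zeta : R) (d : lmi_vars R p.+1 n) :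
  lmi_feasible a A B delta zeta d -> 0 < phi d.
Proof. by case=> _ [_ _ t3 g _] _ _ _; rewrite sqrtr_gt0 divr_gt0. Qed.

Theorem theorem2 (R : realType) (p n m : nat)
    (a : 'M[R]_p.+1) (A : 'M[R]_n) (B : 'I_p.+1 -> 'M[R]_(n, m))
    (delta zeta eps : R) (deltac : 'I_p.+1 -> R)
    (d : lmi_vars R p.+1 n) (T : \bar R) (w : trajectory R p.+1 n m)
    (i : 'I_p.+1) (k : nat) :
  adjacency a -> has_spanning_tree a -> row_free (Lhat a) ->
  (forall j, controllable A (B j)) ->
  0 < delta -> 0 < zeta -> 0 <= eps -> (forall j, 0 < deltac j) ->
  lmi_solution a A B delta zeta eps d ->
  closed_loop a A B (gain B d) (phi d) delta deltac T w ->
  A != 0 ->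
  0 < Fbar a A B (gain B d) T w i k ->
  (tk w i k < +oo)%E ->
  deltac i <= fnorm (Xhat a w i (fine (tk w i k))) ->
  (0 < tk w i k.+1 - tk w i k)%E /\
  (threshold_kept a w i k ->
   (((fnorm A)^-1 *
     ln (phi d * fnorm A * fnorm (Xhat a w i (fine (tk w i k)))
         / Fbar a A B (gain B d) T w i k + 1))%:E
    <= tk w i k.+1 - tk w i k)%E).
Proof.
move=> _ _ _ _ _ _ _ deltac0 [/phi_gt0 phi0 _] cl A0 F0 koo dX.
have ks : tk w i k = (fine (tk w i k))%:E.
  by rewrite fineK// ge0_fin_numE// (tk_ge0 cl).
have X0 := lt_le_trans (deltac0 i) dX.
have kk := tk_lt_tkS cl phi0 koo X0.
split; first by rewrite sube_gt0.
rewrite /threshold_kept; move: X0 {dX}; set X := fnorm (Xhat _ _ _ _) => X0.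
move: ks kk; set s := fine _ => ks.
(* Without a further transmission the interval is infinite and the bound is immediate; the value
   [-oo] contradicts [kk]. *)
case kt : (tk w i k.+1) => [t| |]; last 2 first.
- by rewrite ks /= leey.
- by rewrite ks.
move=> _ /(_ _ erefl) Xt; rewrite ks -EFinB lee_fin.
have [_ _ et] := tkS_fin cl kt.
have := fnorm_held_error_le cl A0 F0 ks kt; move: F0.
have := fnorm_gt0 A0; set F := Fbar _ _ _ _ _ _ _ _; set al := fnorm A.
move=> al0 F0 eF.
(* Multiplying by [al] and exponentiating reduces the claim to [phi d * X <= (expR (al * (t - s)) -
   1) * F / al]. Here [Xt], the instance of [threshold_kept] at [t], passes from [X] to the norm
   that fires the event; [et] and [eF] then conclude. *)
rewrite ler_pdivrMl// -[leRHS]expRK ler_ln ?posrE ?expR_gt0//; last first.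
  by rewrite ltr_wpDl// !(mulr_ge0, invr_ge0)// ltW.
rewrite -lerBrDr ler_pdivrMr// mulrAC -ler_pdivlMr//.
apply: le_trans (_ : phi d * X <= _) _ => //.
apply: le_trans (ler_wpM2l (ltW phi0) Xt) _.
by apply: le_trans et (le_trans eF _); rewrite -[leRHS]mulrA [leRHS]mulrC.
Qed.
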